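(* Let $G$ be a 1-dof tree-decomposable graph. Then either $G$ is LCC on every one of its base nonedges, or $G$ is LCC on none of its base nonedges.
   Context: All graphs are finite and simple. A nonedge of a graph $G$ is a pair of distinct vertices not joined by an edge, and $G\cup f$ denotes $G$ with the edge $f$ added. A graph is tree-decomposable if it is a single edge, or it is the union of three tree-decomposable graphs such that each pair shares exactly one vertex and the three shared vertices are distinct. A graph $G$ is 1-dof tree-decomposable if it has a nonedge $f$ such that $G\cup f$ is tree-decomposable; every such $f$ is called a base nonedge of $G$. A cluster of a 1-dof tree-decomposable graph $G$ is a maximal tree-decomposable subgraph of $G$. Construction from a base nonedge $f=(v_0,v_0')$: $G$ is built starting from $G_f(0)$, the graph with the two vertices $v_0,v_0'$ and no edges. At the $k$-th construction step, written $v_k\triangleleft(u_k,w_k)$, two new clusters $T,T'$ of $G$ that share exactly one vertex $v_k$ (the step vertex) are appended to $G_f(k-1)$, where $T\cap G_f(k-1)$ is the single vertex $u_k$, $T'\cap G_f(k-1)$ is the single vertex $w_k$, and $u_k\neq w_k$; the result is $G_f(k)$. The steps may be ordered arbitrarily as long as $u_k,w_k\in G_f(k-1)$ for each $k$. The $k$-th extreme graph $\hat G_f(k)$ is $G_f(k-1)$ with the edge $(u_k,w_k)$ added. $G$ is LCC (has low Cayley complexity) on $f$ if all extreme graphs in the construction of $G$ from $f$ are tree-decomposable. *)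

(* Defs.v *)
From mathcomp Require Import all_boot.

Set Implicit Arguments.
Unset Strict Implicit.
Unset Printing Implicit Defensive.

(* Finite simple graphs whose vertices are taken in an ambient finite type T:
   an edge is a two-element subset of the vertex set. *)
Definition graph_wf (T : finType) (V : {set T}) (E : {set {set T}}) : bool :=
  [forall e in E, (e \subset V) && (#|e| == 2)].

Record graph (T : finType) : Type := Graph {
  vset : {set T};
  eset : {set {set T}};
  graphP : graph_wf vset eset
}.

Lemma graph_eq (T : finType) (G H : graph T) :
  vset G = vset H -> eset G = eset H -> G = H.
Proof.
case: G => VG EG wG; case: H => VH EH wH /= eV eE; subst VH EH.
by rewrite (bool_irrelevance wG wH).
Qed.

Lemma gunion_wf (T : finType) (G H : graph T) :
  graph_wf (vset G :|: vset H) (eset G :|: eset H).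
Proof.
apply/forall_inP => e; rewrite inE => /orP [] eX.
- by have /andP [sV ->] := forall_inP (graphP G) e eX; rewrite subsetU ?sV.
- by have /andP [sV ->] := forall_inP (graphP H) e eX; rewrite subsetU ?sV ?orbT.
Qed.

Definition gunion (T : finType) (G H : graph T) : graph T :=
  Graph (gunion_wf G H).

Lemma edgeless_wf (T : finType) (V : {set T}) : graph_wf V set0.
Proof. by apply/forall_inP => e; rewrite inE. Qed.

Definition edgeless (T : finType) (V : {set T}) : graph T :=
  Graph (edgeless_wf V).

Lemma single_edge_wf (T : finType) (f : T * T) :
  graph_wf [set f.1; f.2] (if f.1 != f.2 then [set [set f.1; f.2]] else set0).
Proof.
apply/forall_inP => e; case: ifP => [nf|_]; last by rewrite inE.
by rewrite inE => /eqP ->; rewrite subxx cards2 nf.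
Qed.

(* Made total by a junk value: when f.1 = f.2 this is a single vertex. *)
Definition single_edge (T : finType) (f : T * T) : graph T :=
  Graph (single_edge_wf f).

(* This is G with the edge f added as soon as f is a pair of distinct vertices
   of G, the only case in which it is used. *)
Definition add_edge (T : finType) (G : graph T) (f : T * T) : graph T :=
  gunion G (single_edge f).

Definition subgraph (T : finType) (H G : graph T) : Prop :=
  vset H \subset vset G /\ eset H \subset eset G.

Inductive tree_decomposable (T : finType) : graph T -> Prop :=
| td_edge (u v : T) of u != v : tree_decomposable (single_edge (u, v))
| td_union (A B C : graph T) (x y z : T) of
    tree_decomposable A & tree_decomposable B & tree_decomposable C &
    vset A :&: vset B = [set x] &
    vset B :&: vset C = [set y] &
    vset A :&: vset C = [set z] &
    x != y & y != z & x != z :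
    tree_decomposable (gunion (gunion A B) C).

Definition nonedge (T : finType) (G : graph T) (f : T * T) : Prop :=
  [/\ f.1 \in vset G, f.2 \in vset G, f.1 != f.2 &
      [set f.1; f.2] \notin eset G].

Definition base_nonedge (T : finType) (G : graph T) (f : T * T) : Prop :=
  nonedge G f /\ tree_decomposable (add_edge G f).

Definition one_dof_tree_decomposable (T : finType) (G : graph T) : Prop :=
  exists f : T * T, base_nonedge G f.

Definition cluster (T : finType) (G C : graph T) : Prop :=
  [/\ tree_decomposable C, subgraph C G &
      forall D : graph T,
        tree_decomposable D -> subgraph D G -> subgraph C D -> D = C].

(* The data of one construction step v <| (u, w): the clusters c and c' share
   the step vertex v and are attached at u and w respectively. *)
Record step (T : finType) : Type := Step {
  step_v : T;
  step_u : T;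
  step_w : T;
  step_c : graph T;
  step_c' : graph T
}.

Definition valid_step (T : finType) (G H : graph T) (s : step T) : Prop :=
  [/\ cluster G (step_c s) /\ cluster G (step_c' s),
      vset (step_c s) :&: vset (step_c' s) = [set step_v s],
      vset (step_c s) :&: vset H = [set step_u s],
      vset (step_c' s) :&: vset H = [set step_w s] &
      step_u s != step_w s].

Definition append_step (T : finType) (H : graph T) (s : step T) : graph T :=
  gunion (gunion H (step_c s)) (step_c' s).

(* The graph G_f(k), for f the starting nonedge and k the length of ss. *)
Definition built (T : finType) (f : T * T) (ss : seq (step T)) : graph T :=
  foldl (@append_step T) (edgeless [set f.1; f.2]) ss.

(* Steps are numbered from 0 here, so the step of index k is performed on
   built f (take k ss). *)
Definition construction (T : finType) (G : graph T) (f : T * T) (n : nat)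
    (ss : n.-tuple (step T)) : Prop :=
  (forall k : 'I_n, valid_step G (built f (take k ss)) (tnth ss k)) /\
  built f ss = G.

Definition extreme_graph (T : finType) (f : T * T) (n : nat)
    (ss : n.-tuple (step T)) (k : 'I_n) : graph T :=
  add_edge (built f (take k ss)) (step_u (tnth ss k), step_w (tnth ss k)).

(* The construction from f is unique up to the order of the steps; no order is
   privileged, so the extreme graphs of every order are required to be
   tree-decomposable. *)
Definition LCC (T : finType) (G : graph T) (f : T * T) : Prop :=
  forall (n : nat) (ss : n.-tuple (step T)), construction G f ss ->
    forall k : 'I_n, tree_decomposable (extreme_graph f ss k).

(* Main.v *)
Require Import Defs.
From mathcomp Require Import all_boot.
From mathcomp Require Import zify.
From Stdlib Require Classical_Prop.

(* A tree-decomposable graph satisfies the Laman count: a set X of at least two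
   vertices spans at most 2|X| - 3 edges, and X spans a tree-decomposable
   subgraph as soon as equality holds (X is tight).  Thus clusters are maximal
   tight sets, and the graphs G_f(k) correspond to the vertex sets W containing
   f that span 2|W| - 4 edges and are unions of clusters; this makes LCC on f a
   property of these sets W instead of construction sequences.

   If G is LCC on f, then G is obtained from an edgeless pair by appending steps
   v <| (u, w) to graphs H of which (u, w) is a base nonedge, a property that no
   longer mentions f.  Conversely, by induction such a G = H + T + T' is LCC on
   every base nonedge g: for a set W built from g,
   - if W contains T and T', then W minus T and T' is built in H from the base
     nonedge (u, w), whatever g is;
   - if W contains only T, then W is the union of T and a tight set of H meeting
     in u, so any extreme graph on W is a triangle;
   - if W contains neither, then W is in H, or is the pair g itself. *)

Set Implicit Arguments.
Unset Strict Implicit.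
Unset Printing Implicit Defensive.

(** * Edge counts in tree-decomposable graphs *)

Section Counting.
Variable T : finType.
Implicit Types (G H K A B C D : graph T) (X Y Z W : {set T}) (f : T * T).

Definition edges_in G X : {set {set T}} := [set e in eset G | e \subset X].

Definition ne G X : nat := #|edges_in G X|.

Lemma induced_wf G X : graph_wf X (edges_in G X).
Proof.
apply/forall_inP => e; rewrite inE => /andP [eG ->] /=.
by have /andP [_ ->] := forall_inP (graphP G) e eG.
Qed.

Definition induced G X : graph T := Graph (induced_wf G X).

Lemma edge_sub G e : e \in eset G -> e \subset vset G.
Proof. by move=> eG; have /andP [] := forall_inP (graphP G) e eG. Qed.

Lemma edge_card G e : e \in eset G -> #|e| = 2.
Proof. by move=> eG; have /andP [_ /eqP] := forall_inP (graphP G) e eG. Qed.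

Lemma ne_small G X : #|X| <= 1 -> ne G X = 0.
Proof.
move=> X1; apply/eqP; rewrite cards_eq0; apply/eqP/setP => e.
rewrite !inE; apply/andP => -[eG eX].
by have := subset_leq_card eX; rewrite (edge_card eG) leqNgt ltnS X1.
Qed.

Lemma ne_mono G X Y : X \subset Y -> ne G X <= ne G Y.
Proof.
move=> sXY; apply/subset_leq_card/subsetP => e; rewrite !inE => /andP [-> eX].
exact: subset_trans eX sXY.
Qed.

Lemma ne_subgraph G K X : eset G \subset eset K -> ne G X <= ne K X.
Proof.
move=> /subsetP sGK; apply/subset_leq_card/subsetP => e.
by rewrite !inE => /andP [/sGK -> ->].
Qed.

Lemma ne_vset G : ne G (vset G) = #|eset G|.
Proof.
by congr #|pred_of_set _|; apply/setP => e; rewrite inE andb_idr // => /edge_sub.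
Qed.

Lemma ne_setI G X : ne G (X :&: vset G) = ne G X.
Proof.
congr #|pred_of_set _|; apply/setP => e; rewrite !inE subsetI.
by case eG: (e \in eset G) => //=; rewrite edge_sub ?andbT.
Qed.

Lemma ne_supermodular G X Y :
  ne G X + ne G Y <= ne G (X :|: Y) + ne G (X :&: Y).
Proof.
rewrite /ne -cardsUI; apply: leq_add; apply/subset_leq_card/subsetP => e.
  rewrite !inE => /orP [] /andP [-> eX] /=; apply: subset_trans eX _.
    exact: subsetUl.
  exact: subsetUr.
by rewrite !inE subsetI => /andP [/andP [-> ->] /andP [_ ->]].
Qed.

Lemma edge_disjoint A B x e :
  vset A :&: vset B = [set x] -> e \in eset A -> e \in eset B -> False.
Proof.
move=> ABx eA eB; have: e \subset [set x] by rewrite -ABx subsetI !edge_sub.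
by move/subset_leq_card; rewrite (edge_card eA) cards1.
Qed.

(** * Counting in three graphs that pairwise share one vertex *)

Section Triangle.
Variables (A B C : graph T) (x y z : T).
Hypotheses (ABx : vset A :&: vset B = [set x]) (BCy : vset B :&: vset C = [set y])
  (ACz : vset A :&: vset C = [set z]).
Hypotheses (xy : x != y) (yz : y != z) (xz : x != z).

Let K := gunion (gunion A B) C.

Lemma triangle_apex :
  [/\ x \in vset A, x \in vset B & x \notin vset C] /\
  [/\ y \notin vset A, y \in vset B & y \in vset C] /\
  [/\ z \in vset A, z \notin vset B & z \in vset C].
Proof.
have /setIP [xA xB]: x \in vset A :&: vset B by rewrite ABx inE.
have /setIP [yB yC]: y \in vset B :&: vset C by rewrite BCy inE.
have /setIP [zA zC]: z \in vset A :&: vset C by rewrite ACz inE.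
split; last split; split => //; apply/negP => m.
- by have: x \in [set z] by [rewrite -ACz inE xA]; rewrite inE (negbTE xz).
- by have: y \in [set x] by [rewrite -ABx inE m]; rewrite inE eq_sym (negbTE xy).
- by have: z \in [set y] by [rewrite -BCy inE m]; rewrite inE eq_sym (negbTE yz).
Qed.

(** Inclusion-exclusion: an apex lies in exactly two of the three graphs, any other vertex of [K] in
    exactly one. *)
Lemma triangle_card X :
  #|X :&: vset K| + (x \in X) + (y \in X) + (z \in X) =
  #|X :&: vset A| + #|X :&: vset B| + #|X :&: vset C|.
Proof.
have [[xA xB xC] [[yA yB yC] [zA zB zC]]] := triangle_apex.
have c1 (t : T) : #|X :&: [set t]| = (t \in X).
  case tX: (t \in X); first by rewrite (setIidPr _) ?sub1set ?cards1.
  apply/eqP; rewrite cards_eq0; apply/eqP/setP => t'; rewrite !inE.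
  by apply/andP => -[tX' /eqP te]; rewrite te tX in tX'.
have cAB := cardsUI (X :&: vset A) (X :&: vset B).
rewrite -setIIr ABx c1 -setIUr in cAB.
have := cardsUI (X :&: (vset A :|: vset B)) (X :&: vset C).
rewrite -setIIr setIUl ACz BCy -setIUr.
have -> : #|X :&: ([set z] :|: [set y])| = (y \in X) + (z \in X).
  rewrite setIUr -(c1 y) -(c1 z) addnC -cardsUI -setIIr.
  suff -> : [set z] :&: [set y] = set0 by rewrite setI0 cards0 addn0.
  by apply/setP => t; rewrite !inE; apply/andP => -[/eqP -> /eqP tz]; case/eqP: yz.
by move: cAB; rewrite /K /=; clear; lia.
Qed.

Lemma triangle_ne X : ne K X = ne A X + ne B X + ne C X.
Proof.
rewrite /ne; have -> : edges_in K X = edges_in A X :|: edges_in B X :|: edges_in C X.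
  by apply/setP => e; rewrite !inE !andb_orl.
rewrite cardsU (_ : _ :&: edges_in C X = set0).
  rewrite cards0 subn0 cardsU (_ : _ :&: _ = set0) ?cards0 ?subn0 //.
  apply/setP => e; rewrite !inE; apply/andP => -[/andP [eA _] /andP [eB _]].
  exact: (@edge_disjoint A B x e).
apply/setP => e; rewrite !inE; apply/andP => -[/orP [] /andP [e1 _] /andP [e2 _]].
  exact: (@edge_disjoint A C z e).
exact: (@edge_disjoint B C y e).
Qed.

Lemma triangle_apex_card X :
  [/\ (x \in X) + (z \in X) <= #|X :&: vset A|,
      (x \in X) + (y \in X) <= #|X :&: vset B| &
      (y \in X) + (z \in X) <= #|X :&: vset C|].
Proof.
have [[xA xB xC] [[yA yB yC] [zA zB zC]]] := triangle_apex.
have c2 a b (V : {set T}) : a != b -> a \in V -> b \in V -> (a \in X) + (b \in X) <= #|X :&: V|.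
  move=> ab aV bV; case aX: (a \in X); case bX: (b \in X) => //=.
  - have <- : #|[set a; b]| = 1 + 1 by rewrite cards2 ab.
    by apply: subset_leq_card; rewrite subUset !sub1set !inE aX bX aV bV.
  - by rewrite addn0 card_gt0; apply/set0Pn; exists a; rewrite inE aX.
  - by rewrite add0n card_gt0; apply/set0Pn; exists b; rewrite inE bX.
by split; apply: c2 => //; rewrite eq_sym.
Qed.

End Triangle.

(** Each apex is counted twice, so the three pieces together have 2 (|V| + 3) - 9 = 2 |V| - 3
    edges. *)
Lemma td_card K : tree_decomposable K ->
  1 < #|vset K| /\ #|eset K| + 3 = 2 * #|vset K|.
Proof.
elim=> {K} [u v uv|A B C x y z _ [A2 eA] _ [B2 eB] _ [C2 eC] ABx BCy ACz xy yz xz].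
  by rewrite /= uv cards1 cards2 uv.
have [[xA xB xC] [[yA yB yC] [zA zB zC]]] := triangle_apex ABx BCy ACz xy yz xz.
set K := gunion _ _.
have := triangle_ne ABx BCy ACz (vset K); rewrite ne_vset.
have := triangle_card ABx BCy ACz xy yz xz (vset K); rewrite -/K setIid.
have sA: vset A \subset vset K by rewrite /= -setUA subsetUl.
have sB: vset B \subset vset K by rewrite /= setUAC subsetUr.
have sC: vset C \subset vset K by rewrite /= subsetUr.
rewrite !(setIidPr _) // (subsetP sA x) // (subsetP sA z) // (subsetP sB y) //.
rewrite -(ne_setI A) -(ne_setI B) -(ne_setI C) !(setIidPr _) // !ne_vset.
by move: A2 eA B2 eB C2 eC; clear; lia.
Qed.

(** Only the pieces meeting [X] in at least two vertices contribute edges, and these obey the bound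
    by induction; the apices in [X] correct the vertex count. *)
Lemma td_sparse K X : tree_decomposable K -> 1 < #|X| -> ne K X + 3 <= 2 * #|X|.
Proof.
move=> tK; elim: tK X => {K} [u v uv|A B C x y z _ IA _ IB _ IC ABx BCy ACz xy yz xz] X X2.
  have : ne (single_edge (u, v)) X <= 1.
    rewrite -(ne_setI _ X); apply: leq_trans (ne_mono _ (subsetIr _ _)) _.
    by rewrite ne_vset /= uv cards1.
  lia.
set K := gunion _ _.
have := triangle_card ABx BCy ACz xy yz xz X; rewrite -/K.
have [] := triangle_apex_card ABx BCy ACz xy yz xz X.
have := triangle_ne ABx BCy ACz X; rewrite -/K.
have: #|X :&: vset K| <= #|X| by apply/subset_leq_card/subsetIl.
have sp D : (forall X, 1 < #|X| -> ne D X + 3 <= 2 * #|X|) ->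
   if 1 < #|X :&: vset D| then ne D X + 3 <= 2 * #|X :&: vset D| else ne D X == 0.
  by move=> ID; rewrite -ne_setI; case: ltnP => [/ID //|le1]; rewrite ne_small ?eqxx.
have := sp A IA; have := sp B IB; have := sp C IC.
move: X2; clear; do 3 case: (ltnP 1 #|_ :&: _|) => /= ?; move=> *.
all: lia.
Qed.

Lemma td_union_sub A B C K x y z :
    tree_decomposable A -> tree_decomposable B -> tree_decomposable C ->
    vset A :&: vset B = [set x] -> vset B :&: vset C = [set y] ->
    vset A :&: vset C = [set z] -> x != y -> y != z -> x != z ->
    vset K = vset A :|: vset B :|: vset C ->
    eset K = eset A :|: eset B :|: eset C ->
  tree_decomposable K.
Proof.
move=> tA tB tC ABx BCy ACz xy yz xz vK eK.
rewrite (@graph_eq _ K (gunion (gunion A B) C)) //.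
exact: td_union ABx BCy ACz xy yz xz.
Qed.

(** Equality in the sparsity bound leaves two cases: [X] contains the three apices and meets every
    piece in a tight set, or [X] lies inside one piece. *)
Lemma td_induced K X : tree_decomposable K -> X \subset vset K ->
  1 < #|X| -> ne K X + 3 = 2 * #|X| -> tree_decomposable (induced K X).
Proof.
move=> tK; elim: tK X => {K} [u v uv|A B C x y z tA IA tB IB tC IC ABx BCy ACz xy yz xz] X sX X2 tX.
  have eX : X = [set u; v].
    by apply/eqP; rewrite eqEcard sX /= cards2 uv.
  rewrite (_ : induced _ _ = single_edge (u, v)); first exact: td_edge.
  apply: graph_eq => //=; apply/setP => e; rewrite inE /= uv inE.
  by apply/andb_idr => /eqP ->; rewrite eX.
move: sX tX; set K := gunion _ _ => sX tX.
have := triangle_card ABx BCy ACz xy yz xz X; rewrite -/K (setIidPl sX) => cX.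
have [c1 c2 c3] := triangle_apex_card ABx BCy ACz xy yz xz X.
have nX := triangle_ne ABx BCy ACz X; rewrite -/K in nX.
have sp D : tree_decomposable D ->
   if 1 < #|X :&: vset D| then ne D X + 3 <= 2 * #|X :&: vset D| else ne D X == 0.
  by move=> tD; rewrite -ne_setI; case: ltnP => [/(td_sparse tD) //|le1]; rewrite ne_small ?eqxx.
have spA := sp _ tA; have spB := sp _ tB; have spC := sp _ tC.
have inside D : tree_decomposable D -> eset D \subset eset K -> #|X :&: vset D| = #|X| ->
    ne D X = ne K X -> (X \subset vset D -> tree_decomposable (induced D X)) ->
    tree_decomposable (induced K X).
  move=> tD sDK cXD nXD IX.
  have sXD : X \subset vset D.
    by apply/setIidPl/eqP; rewrite eqEcard subsetIl cXD /=.
  rewrite (_ : induced K X = induced D X); first exact: IX.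
  apply: graph_eq => //=; apply/esym/eqP; rewrite eqEcard; apply/andP; split; last by rewrite -/(ne K X) -nXD.
  by apply/subsetP => e; rewrite inE => /andP [/(subsetP sDK) eK eX]; rewrite inE eK eX.
have sA: eset A \subset eset K by rewrite /= -setUA subsetUl.
have sB: eset B \subset eset K by rewrite /= setUAC subsetUr.
have sC: eset C \subset eset K by rewrite /= subsetUr.
move: spA spB spC; case: ltnP => a2; case: ltnP => b2; case: ltnP => d2 nA nB nC.
(* With [a] apices in [X] the three bounds add up to 2 |X| + 2 a - 9, so tightness forces a = 3. *)
- have /and3P [xX yX zX] : [&& x \in X, y \in X & z \in X].
    by move: a2 b2 d2 nA nB nC cX nX tX; clear; do 3 case: (_ \in X) => //=; lia.
  rewrite xX yX zX in cX c1 c2 c3.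
  have piece D (tD : tree_decomposable D)
      (ID : forall X, X \subset vset D -> 1 < #|X| -> ne D X + 3 = 2 * #|X| ->
        tree_decomposable (induced D X)) :
      1 < #|X :&: vset D| -> ne D X + 3 = 2 * #|X :&: vset D| ->
      tree_decomposable (induced D (X :&: vset D)).
    by move=> D2 nD; apply: ID; rewrite ?ne_setI ?subsetIr.
  have XI a b d : a :&: b = [set d] -> d \in X -> (X :&: a) :&: (X :&: b) = [set d].
    move=> abd dX; rewrite -setIIr abd; apply/setIidPr; by rewrite sub1set.
  apply: (@td_union_sub (induced A (X :&: vset A)) (induced B (X :&: vset B))
    (induced C (X :&: vset C)) _ x y z) => //=.
  + by apply: piece => //; move: nA nB nC cX nX tX; clear -a2 b2 d2; lia.
  + by apply: piece => //; move: nA nB nC cX nX tX; clear -a2 b2 d2; lia.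
  + by apply: piece => //; move: nA nB nC cX nX tX; clear -a2 b2 d2; lia.
  + exact: XI.
  + exact: XI.
  + exact: XI.
  + by rewrite -!setIUr; apply/esym/setIidPl.
  apply/setP => e; rewrite !inE !subsetI.
  case eA: (e \in eset A) => /=; first by rewrite (edge_sub eA) andbT;
      case: (e \subset X); rewrite //= !andbF.
  case eB: (e \in eset B) => /=; first by rewrite (edge_sub eB) andbT;
      case: (e \subset X); rewrite //= !andbF.
  by case eC: (e \in eset C) => //=; rewrite (edge_sub eC) andbT.
all: try by move: a2 b2 d2 nA nB nC c1 c2 c3 cX nX tX X2; clear; lia.
- by apply: (inside A) => //; try (move=> sXA; apply: IA => //);
    move: a2 b2 d2 nA nB nC c1 c2 c3 cX nX tX X2; clear; lia.
- by apply: (inside B) => //; try (move=> sXA; apply: IB => //);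
    move: a2 b2 d2 nA nB nC c1 c2 c3 cX nX tX X2; clear; lia.
- by apply: (inside C) => //; try (move=> sXA; apply: IC => //);
    move: a2 b2 d2 nA nB nC c1 c2 c3 cX nX tX X2; clear; lia.
Qed.

End Counting.

(** * Tight vertex sets and clusters *)

Section Tight.
Variable T : finType.
Implicit Types (G H K A B C D : graph T) (X Y Z W : {set T}) (f : T * T).

Lemma td_vertex_edge D x : tree_decomposable D -> x \in vset D ->
  exists2 e, e \in eset D & x \in e.
Proof.
elim=> {D} [u v uv xD|A B C _ _ _ _ IA _ IB _ IC _ _ _ _ _ _].
  by exists [set u; v]; rewrite //= uv inE.
rewrite /= !inE => /orP [/orP [/IA|/IB]|/IC] [e eD xe]; exists e => //.
all: by rewrite !inE eD ?orbT.
Qed.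

(** Sparsity passes to subgraphs, so a graph with a base nonedge inherits it from the graph
    completed by that nonedge. *)
Definition in_td G := exists2 K, tree_decomposable K & subgraph G K.

Definition tight G X := [&& X \subset vset G, 1 < #|X| & ne G X + 3 == 2 * #|X|].

Lemma in_td_sparse G X : in_td G -> 1 < #|X| -> ne G X + 3 <= 2 * #|X|.
Proof.
move=> [K tK [_ sE]] X2; apply: leq_trans (td_sparse tK X2).
by rewrite leq_add2r ne_subgraph.
Qed.

Lemma subgraph_refl G : subgraph G G. Proof. by split. Qed.

Lemma subgraph_trans G H K : subgraph G H -> subgraph H K -> subgraph G K.
Proof. by move=> [v1 e1] [v2 e2]; split; [apply: subset_trans v2|apply: subset_trans e2]. Qed.

Lemma in_td_subgraph G H : in_td G -> subgraph H G -> in_td H.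
Proof. by move=> [K tK sGK] sHG; exists K => //; apply: subgraph_trans sGK. Qed.

Lemma induced_subgraph G X : X \subset vset G -> subgraph (induced G X) G.
Proof. by move=> sX; split => //=; apply/subsetP => e; rewrite inE => /andP []. Qed.

(** [D] already has the 2n - 3 edges that sparsity of [G] allows on its n vertices. *)
Lemma edges_in_td_subgraph G D : in_td G -> tree_decomposable D -> subgraph D G ->
  edges_in G (vset D) = eset D.
Proof.
move=> tG tD [sV sE]; have [D2 nD] := td_card tD.
apply/esym/eqP; rewrite eqEcard; apply/andP; split.
  by apply/subsetP => e eD; rewrite inE (subsetP sE) ?edge_sub.
have := in_td_sparse tG D2; rewrite /ne -nD; lia.
Qed.

Lemma td_tight G D : in_td G -> tree_decomposable D -> subgraph D G ->
  tight G (vset D).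
Proof.
move=> tG tD sD; have [D2 nD] := td_card tD.
by rewrite /tight D2 /ne (edges_in_td_subgraph tG tD sD) nD eqxx; case: sD => ->.
Qed.

Lemma td_subgraph_induced G D : in_td G -> tree_decomposable D -> subgraph D G ->
  D = induced G (vset D).
Proof. by move=> tG tD sD; apply: graph_eq; rewrite //= (edges_in_td_subgraph tG tD sD). Qed.

(** A tight set has no room for further edges in a larger sparse graph. *)
Lemma tight_subgraph G H X : in_td H -> subgraph G H -> tight G X ->
  tight H X /\ induced G X = induced H X.
Proof.
move=> tH [sV sE] /and3P [sX X2 /eqP nX].
have leH := in_td_sparse tH X2; have leG := ne_subgraph X sE.
split; first by rewrite /tight X2 (subset_trans sX sV) /=; lia.
apply: graph_eq => //=; apply/eqP; rewrite eqEcard; apply/andP; split.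
  by apply/subsetP => e; rewrite !inE => /andP [/(subsetP sE) -> ->].
by move: leH leG nX; rewrite /ne; lia.
Qed.

(** The set stays tight, with the same induced graph, in a tree-decomposable graph containing [G],
    where [td_induced] applies. *)
Lemma tight_td G X : in_td G -> tight G X -> tree_decomposable (induced G X).
Proof.
move=> [K tK sGK] tX; have tK' : in_td K by exists K => //; exact: subgraph_refl.
have [/and3P [sX X2 /eqP nX] ->] := tight_subgraph tK' sGK tX.
exact: td_induced.
Qed.

(** Uncrossing: supermodularity bounds the two edge counts from below by the sum of the values that
    sparsity imposes as upper bounds, so both are attained. *)
Lemma tightUI G X Y : in_td G -> tight G X -> tight G Y -> 1 < #|X :&: Y| ->
  tight G (X :|: Y) /\ tight G (X :&: Y).
Proof.
move=> tG /and3P [sX X2 /eqP nX] /and3P [sY Y2 /eqP nY] XY2.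
have U2 : 1 < #|X :|: Y| by apply: leq_trans X2 _; apply/subset_leq_card/subsetUl.
have := in_td_sparse tG XY2; have := in_td_sparse tG U2.
have := ne_supermodular G X Y; have := cardsUI X Y => c s n1 n2.
rewrite /tight U2 XY2 subUset sX sY (subset_trans (subsetIl _ _) sX) /=.
by split; apply/eqP; lia.
Qed.

Lemma tight_edge G X : tight G X -> exists2 e, e \in eset G & e \subset X.
Proof.
move=> /and3P [_ X2 /eqP nX]; have : 0 < ne G X by lia.
by rewrite card_gt0 => /set0Pn [e]; rewrite inE => /andP [eG eX]; exists e.
Qed.

Lemma edge_tight G e : in_td G -> e \in eset G -> tight G e.
Proof.
move=> tG eG; have e2 := edge_card eG.
have e21 : 1 < #|e| by rewrite e2.
rewrite /tight edge_sub //= e21; have := in_td_sparse tG e21.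
have : 0 < ne G e by rewrite card_gt0; apply/set0Pn; exists e; rewrite inE eG /=.
by rewrite e2; lia.
Qed.

Lemma cluster_tight G C : in_td G -> cluster G C -> tight G (vset C).
Proof. by move=> tG [tC sC _]; apply: td_tight. Qed.

Lemma cluster_induced G C : in_td G -> cluster G C -> C = induced G (vset C).
Proof. by move=> tG [tC sC _]; apply: td_subgraph_induced. Qed.

Lemma cluster_card G C : cluster G C -> 1 < #|vset C|.
Proof. by case=> tC _ _; case: (td_card tC). Qed.

Lemma cluster_edge G C e : in_td G -> cluster G C -> e \in eset G ->
  e \subset vset C -> e \in eset C.
Proof. by move=> tG cC eG eC; rewrite (cluster_induced tG cC) inE eG. Qed.

(** By uncrossing, the union of [Y] and the cluster is tight, so it induces a tree-decomposable
    subgraph, which maximality identifies with [C]. *)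
Lemma cluster_maximal G C Y : in_td G -> cluster G C -> tight G Y ->
  1 < #|Y :&: vset C| -> Y \subset vset C.
Proof.
move=> tG cC tY YC2; have tC := cluster_tight tG cC.
have [tU _] := tightUI tG tY tC YC2; case: cC => _ sC mC.
have sU : Y :|: vset C \subset vset G by case/and3P: tU.
rewrite -(mC _ (tight_td tG tU) (induced_subgraph sU)) ?subsetUl //.
split => /=; first exact: subsetUr.
apply/subsetP => e eC; rewrite inE (subsetP sC.2) //=.
by apply: subset_trans (edge_sub eC) (subsetUr _ _).
Qed.

Lemma cluster_eq G C D : in_td G -> cluster G C -> cluster G D ->
  1 < #|vset C :&: vset D| -> C = D.
Proof.
move=> tG cC cD CD2; rewrite (cluster_induced tG cC) (cluster_induced tG cD).
congr induced; apply/eqP; rewrite eqEsubset.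
by rewrite !(@cluster_maximal G) ?cluster_tight // setIC.
Qed.

(** A tight set of largest cardinality containing [Y] induces the cluster. *)
Lemma tight_in_cluster G Y : in_td G -> tight G Y ->
  exists2 C, cluster G C & Y \subset vset C.
Proof.
move=> tG tY; pose P Z := tight G Z && (Y \subset Z).
have PY : P Y by rewrite /P tY /=.
case: (arg_maxnP (fun Z => #|Z|) PY) => Z /andP [tZ sYZ] mZ.
exists (induced G Z) => //=; split; [exact: tight_td|by case/and3P: tZ => /induced_subgraph|].
move=> D tD sD [sZD _]; rewrite (td_subgraph_induced tG tD sD); congr induced.
apply/eqP; rewrite eq_sym eqEcard sZD; apply: mZ.
by rewrite /P (td_tight tG tD sD) (subset_trans sYZ sZD).
Qed.

Lemma cluster_subgraph G H C : cluster G C -> subgraph H G -> subgraph C H ->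
  cluster H C.
Proof.
move=> [tC sC mC] sHG sCH; split => // D tD sDH sCD.
by apply: mC => //; apply: subgraph_trans sHG.
Qed.

(* Otherwise the union of [C], [C'] and [D] would contradict maximality of [C]. *)
Lemma clusters_no_triangle G C C' D p q r : cluster G C -> cluster G C' ->
    tree_decomposable D -> subgraph D G ->
    vset C :&: vset C' = [set p] -> vset C :&: vset D = [set q] ->
    vset C' :&: vset D = [set r] -> p != q -> p != r -> q != r -> False.
Proof.
move=> [tC sC mC] cC' tD sD CC' CD C'D pq pr qr; have C'2 := cluster_card cC'.
case: cC' => tC' sC' _.
have eqC : gunion (gunion C C') D = C.
  apply: mC; first by apply: td_union CC' C'D CD _ _ _; rewrite // eq_sym.
    case: sC sC' sD => vC eC [vC' eC'] [vD eD].
    by split; rewrite /= !subUset ?vC ?vC' ?vD ?eC ?eC' ?eD.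
  by split; rewrite /= -setUA subsetUl.
have : vset C' \subset [set p].
  by rewrite -CC' subsetI subxx andbT -eqC /= setUAC subsetUr.
by move/subset_leq_card; rewrite cards1 leqNgt C'2.
Qed.

End Tight.

(** * Vertex sets of the graphs built from a base nonedge *)

Section Closed.
Variable T : finType.
Implicit Types (G H K A B C D : graph T) (X Y Z W : {set T}) (f : T * T).
Implicit Types (s : step T).

Lemma card_gt1_mem X x y : x \in X -> y \in X -> x != y -> 1 < #|X|.
Proof. by move=> xX yX xy; apply/card_gt1P; exists x, y. Qed.

Lemma card_le1_mem X x : x \in X -> #|X| <= 1 -> X = [set x].
Proof.
move=> xX X1; apply/esym/eqP; rewrite eqEcard sub1set xX /=.
by rewrite cards1.
Qed.

Lemma vset_add_edge G f : [set f.1; f.2] \subset vset G ->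
  vset (add_edge G f) = vset G.
Proof. by move=> /= /setUidPl. Qed.

Lemma eset_add_edge G f : f.1 != f.2 ->
  eset (add_edge G f) = [set f.1; f.2] |: eset G.
Proof. by move=> /= ->; rewrite setUC. Qed.

Lemma add_edge_swap G x y : add_edge G (x, y) = add_edge G (y, x).
Proof. by apply: graph_eq; rewrite /= (setUC [set x]) // eq_sym. Qed.

Lemma ne_add_edge G f X : nonedge G f ->
  ne (add_edge G f) X = ne G X + ([set f.1; f.2] \subset X).
Proof.
move=> [_ _ f12 fG]; rewrite addnC /ne.
case: (boolP (_ \subset X)) => fX.
  rewrite -[true + _]/(1 + _) (_ : edges_in _ X = [set f.1; f.2] |: edges_in G X).
    by rewrite cardsU1 inE (negbTE fG).
  apply/setP => e; rewrite inE eset_add_edge // !inE.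
  by case: eqP => [->|].
rewrite add0n; congr #|pred_of_set _|; apply/setP => e.
rewrite inE eset_add_edge // !inE.
by case: eqP => [->|] //=; rewrite (negbTE fX) andbF.
Qed.

Lemma base_sub G f : base_nonedge G f -> [set f.1; f.2] \subset vset G.
Proof. by case=> -[f1 f2 _ _] _; rewrite subUset !sub1set f1 f2. Qed.

Lemma add_base_in_td G f : base_nonedge G f -> in_td (add_edge G f).
Proof. by case=> _ tG; exists (add_edge G f) => //; apply: subgraph_refl. Qed.

Lemma subgraph_add_edge G f : subgraph G (add_edge G f).
Proof. by split; rewrite /= subsetUl. Qed.

Lemma base_in_td G f : base_nonedge G f -> in_td G.
Proof. by move=> /add_base_in_td tG; apply: in_td_subgraph tG (subgraph_add_edge G f). Qed.

(** Adding [f] would otherwise put 2 |X| - 2 edges on [X], one too many. *)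
Lemma base_not_tight G f X : base_nonedge G f -> tight G X ->
  [set f.1; f.2] \subset X = false.
Proof.
move=> bG /and3P [_ X2 /eqP nX]; apply/negbTE/negP => fX.
have := in_td_sparse (add_base_in_td bG) X2; rewrite ne_add_edge ?fX; last by case: bG.
lia.
Qed.

(** A step vertex already in [H] would be equal to both attachment vertices. *)
Lemma valid_step_apex G H s : valid_step G H s ->
  [/\ step_v s \notin vset H, step_v s != step_u s & step_v s != step_w s].
Proof.
case: s => v u w C C' [] /= _ CC' CH C'H uw.
have /setIP [vC vC']: v \in vset C :&: vset C' by rewrite CC' inE.
have /setIP [uC uH]: u \in vset C :&: vset H by rewrite CH inE.
have /setIP [wC' wH]: w \in vset C' :&: vset H by rewrite C'H inE.
have vH : v \notin vset H.
  apply/negP => vH; have: v \in vset C :&: vset H by rewrite inE vC.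
  have: v \in vset C' :&: vset H by rewrite inE vC'.
  by rewrite CH C'H !inE => /eqP -> /eqP wu; rewrite wu eqxx in uw.
by split=> //; apply: contraNneq vH => ->.
Qed.

(* These are the vertex sets of the graphs [built f ss] for initial segments [ss]
   of the constructions of [G] from [f]. *)
Definition base_closed G f W : Prop :=
  [/\ [set f.1; f.2] \subset W, W \subset vset G, ne G W + 4 = 2 * #|W| &
      forall C e, cluster G C -> e \in eset C -> e \subset W -> vset C \subset W].

Section Base.
Variables (G : graph T) (f : T * T).
Hypothesis bG : base_nonedge G f.

Let ndG : nonedge G f. Proof. by case: bG. Qed.
Let f12 : f.1 != f.2. Proof. by case: ndG. Qed.
Let tG : in_td G := base_in_td bG.
Let tGf : in_td (add_edge G f) := add_base_in_td bG.

Lemma fpair_card : #|[set f.1; f.2]| = 2.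
Proof. by rewrite cards2 f12. Qed.

Lemma fset_card W : [set f.1; f.2] \subset W -> 1 < #|W|.
Proof. by move/subset_leq_card; rewrite fpair_card. Qed.

Lemma ne_base W : [set f.1; f.2] \subset W -> ne G W + 4 <= 2 * #|W|.
Proof.
move=> fW; have := in_td_sparse tGf (fset_card fW).
by rewrite ne_add_edge // fW; lia.
Qed.

(** The 4 in [base_closed] is the 3 of tightness plus one for the missing edge [f]. *)
Lemma base_closed_tight W : base_closed G f W -> tight (add_edge G f) W.
Proof.
move=> [fW sW nW _]; rewrite /tight vset_add_edge ?base_sub // sW fset_card //=.
by rewrite ne_add_edge // fW; lia.
Qed.

(** Once [f] is added, [C] and [W] are both tight, so their intersection contains an edge. This edge
    is not [f], which no cluster spans, so the closure clause of [base_closed] applies to it. *)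
Lemma base_closed_sat W C : base_closed G f W -> cluster G C -> 1 < #|vset C :&: W| ->
  vset C \subset W.
Proof.
move=> fcW cC CW2; have tC := cluster_tight tG cC.
have [tC' _] := tight_subgraph tGf (subgraph_add_edge G f) tC.
have [_ /tight_edge [e]] := tightUI tGf tC' (base_closed_tight fcW) CW2.
rewrite eset_add_edge // subsetI => /setU1P [->|eG] /andP [eC eW].
  by rewrite (base_not_tight bG tC) in eC.
by case: fcW => _ _ _ sat; apply: sat (cluster_edge tG cC eG eC) eW.
Qed.

Lemma base_closed_pair : base_closed G f [set f.1; f.2].
Proof.
have n0 : ne G [set f.1; f.2] = 0 by have := ne_base (subxx _); rewrite fpair_card; lia.
split; rewrite ?base_sub // ?n0 ?fpair_card // => C e cC eC ef.
have [_ sC _] := cC; have : e \in edges_in G [set f.1; f.2] by rewrite inE (subsetP sC.2).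
by move/eqP: n0; rewrite cards_eq0 => /eqP ->; rewrite inE.
Qed.

Lemma base_closed_vset : base_closed G f (vset G).
Proof.
split=> //; first exact: base_sub; last by move=> C e [_ [sC _] _].
have [_ /td_card [_]] := bG.
by rewrite -ne_vset vset_add_edge ?base_sub // ne_add_edge // base_sub //; lia.
Qed.

(** * Appending a step to a base-closed set *)

Section Append.
Variables (W : {set T}) (s : step T).
Hypotheses (fcW : base_closed G f W) (vs : valid_step G (induced G W) s).

Let C := step_c s.
Let C' := step_c' s.
Let W' := W :|: vset C :|: vset C'.

Lemma append_sub : W' \subset vset G.
Proof.
have [_ sW _ _] := fcW; case: vs => -[[_ [sC _] _] [_ [sC' _] _]] _ _ _ _.
by rewrite !subUset sW sC sC'.
Qed.

Lemma append_esub : eset (append_step (induced G W) s) \subset edges_in G W'.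
Proof.
case: vs => -[[_ [_ sC] _] [_ [_ sC'] _]] _ _ _ _.
apply/subsetP => e; rewrite /= !inE => /orP [/orP [/andP [-> eW]|eC]|eC'] /=.
- by rewrite /W' -setUA (subset_trans eW) // subsetUl.
- by rewrite (subsetP sC) //= /W' setUAC (subset_trans (edge_sub eC)) // subsetUr.
- by rewrite (subsetP sC') //= /W' (subset_trans (edge_sub eC')) // subsetUr.
Qed.

(** The two clusters and the graph on [W] form a triangle, with 2 (|W'| + 3) - 3 - 3 - 4 = 2 |W'| -
    4 edges in all. *)
Lemma append_card : #|eset (append_step (induced G W) s)| + 4 = 2 * #|W'|.
Proof.
have [vW vu vw] := valid_step_apex vs; have [_ _ nW _] := fcW.
case: (vs) => -[[tC _ _] [tC' _ _]] CC' CW C'W uw.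
have [C2 eC] := td_card tC; have [C'2 eC'] := td_card tC'.
set K := append_step _ _.
have [eK vK] : eset K = eset (gunion (gunion C C') (induced G W)) /\
    W' = vset (gunion (gunion C C') (induced G W)).
  by rewrite /K /append_step /W' /=; split; rewrite -setUA setUC.
have wu : step_w s != step_u s by rewrite eq_sym.
have tc := triangle_card CC' C'W CW vw wu vu W'.
have tn := triangle_ne CC' C'W CW W'.
rewrite -vK setIid in tc; rewrite [X in ne _ X]vK ne_vset -eK in tn.
have sub X : X \subset W' -> W' :&: X = X by move/setIidPr.
have sC : vset C \subset W' by rewrite /W' setUAC subsetUr.
have sC' : vset C' \subset W' by rewrite /W' subsetUr.
have sW : W \subset W' by rewrite /W' -setUA subsetUl.
move: tn; rewrite -(ne_setI C) -(ne_setI C') -(ne_setI (induced G W)).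
rewrite !(sub (vset _)) // !ne_vset => tn; rewrite !(sub (vset _)) // in tc.
have /setIP [vC _] : step_v s \in vset C :&: vset C' by rewrite CC' inE.
have /setIP [uC _] : step_u s \in vset C :&: W by rewrite CW inE.
have /setIP [wC' _] : step_w s \in vset C' :&: W by rewrite C'W inE.
rewrite (subsetP sC _ vC) (subsetP sC _ uC) (subsetP sC' _ wC') /= in tc.
have nW' : #|eset (induced G W)| = ne G W by [].
rewrite nW' in tn; move: tn tc eC eC' nW.
rewrite -[step_c s]/C -[step_c' s]/C'; move: #|eset K| #|W'| #|eset C| #|eset C'|; clear; lia.
Qed.

(** The appended graph already has the largest number of edges that [ne_base] allows on [W']. *)
Lemma append_induced : append_step (induced G W) s = induced G W'.
Proof.
apply: graph_eq => //; apply/eqP; rewrite eqEcard append_esub.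
have fW' : [set f.1; f.2] \subset W'.
  by case: fcW => fW _ _ _; rewrite /W' -setUA (subset_trans fW) // subsetUl.
move: append_card (ne_base fW');
by rewrite -[ne G W']/#|eset (induced G W')|; move: #|eset _| #|W'| #|eset _|; clear; lia.
Qed.

Lemma append_base_closed : base_closed G f W'.
Proof.
have [fW sW nW sat] := fcW; split.
- by rewrite /W' -setUA (subset_trans fW) // subsetUl.
- exact: append_sub.
- by rewrite -append_card append_induced.
move=> D e cD eD eW'; case: (vs) => -[cC cC'] _ _ _ _.
have eD2 : 1 < #|e| by rewrite (edge_card eD).
have De X : e \subset X -> 1 < #|vset D :&: X|.
  by move=> eX; apply: leq_trans eD2 (subset_leq_card _); rewrite subsetI edge_sub.
(* Every edge of [G] inside [W'] comes from [W], [C] or [C']; in the last two cases the cluster [D]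
   through it is [C] or [C'] itself. *)
have : e \in eset (append_step (induced G W) s).
  by rewrite append_induced inE eW' andbT; case: cD => _ [_ /subsetP sD] _; apply: sD.
rewrite /= !inE => /orP [/orP [/andP [_ eW]|eC]|eC'].
- by rewrite /W' -setUA (subset_trans (sat D e cD eD eW)) // subsetUl.
- by rewrite (cluster_eq tG cD cC (De _ (edge_sub eC))) /W' setUAC subsetUr.
- by rewrite (cluster_eq tG cD cC' (De _ (edge_sub eC'))) /W' subsetUr.
Qed.

End Append.

(** * Finding a next step between two nested base-closed sets *)

Section Progress.
Variables (W0 W : {set T}).
Hypotheses (fc0 : base_closed G f W0) (fcW : base_closed G f W).

(** [W0] behaves like one more cluster, since it is tight once [f] is added. *)
Let covered X := X \subset W0 \/
  exists C, [/\ cluster G C, vset C \subset W & X \subset vset C].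

Let step_in := exists s, [/\ valid_step G (induced G W0) s,
  vset (step_c s) \subset W & vset (step_c' s) \subset W].

(** The cluster around [Z] shares two vertices with [W0], so saturation puts it inside [W0]. *)
Lemma covered_two X Y Z y z : X \subset W0 -> Y \subset W0 -> covered Z ->
  y \in Y :&: Z -> z \in X :&: Z -> y != z -> covered (X :|: Y :|: Z).
Proof.
move=> sX sY cZ /setIP [yY yZ] /setIP [zX zZ] yz; left; rewrite !subUset sX sY /=.
case: cZ => [//|[C [cC _ sZ]]]; apply: (subset_trans sZ).
apply: (base_closed_sat fc0 cC); apply: card_gt1_mem yz.
  by rewrite inE (subsetP sZ) // (subsetP sY).
by rewrite inE (subsetP sZ) // (subsetP sX).
Qed.

(** Let [P] and [Q] be clusters around [Y] and [Z]. If one of them meets [W0] twice it is absorbed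
    and [covered_two] applies; if they meet each other twice they coincide, and then meet [W0] in
    both [x] and [z]. Otherwise [P] and [Q] form the construction step with step vertex [y] attached
    at [x] and [z]. *)
Lemma covered_one X Y Z x y z : X \subset W0 -> covered Y -> covered Z ->
  x \in X :&: Y -> y \in Y :&: Z -> z \in X :&: Z ->
  x != y -> y != z -> x != z -> covered (X :|: Y :|: Z) \/ step_in.
Proof.
move=> sX cY cZ xXY yYZ zXZ xy yz xz.
case: (cY) => [sY|[P [cP sPW sY]]]; first by left; apply: covered_two yYZ zXZ yz.
case: (cZ) => [sZ|[Q [cQ sQW sZ]]].
  by left; rewrite setUAC; apply: (@covered_two _ _ _ y x); rewrite // 1?setIC // eq_sym.
have /setIP [xX xY] := xXY; have /setIP [yY yZ] := yYZ; have /setIP [zX zZ] := zXZ.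
have xP : x \in vset P :&: W0 by rewrite inE (subsetP sY) // (subsetP sX).
have zQ : z \in vset Q :&: W0 by rewrite inE (subsetP sZ) // (subsetP sX).
have yPQ : y \in vset P :&: vset Q by rewrite inE (subsetP sY) // (subsetP sZ).
case: (ltnP 1 #|vset P :&: W0|) => [/(base_closed_sat fc0 cP) sP|P1].
  by left; apply: covered_two yYZ zXZ yz => //; apply: subset_trans sP.
case: (ltnP 1 #|vset Q :&: W0|) => [/(base_closed_sat fc0 cQ) sQ|Q1].
  left; rewrite setUAC; apply: (@covered_two _ _ _ y x); rewrite // 1?setIC // 1?eq_sym //.
  exact: subset_trans sQ.
case: (ltnP 1 #|vset P :&: vset Q|) => [/(cluster_eq tG cP cQ) ePQ|PQ1].
  by rewrite -ePQ in zQ; have := card_gt1_mem xP zQ xz; rewrite ltnNge P1.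
right; exists (Step y x z P Q); split => //; split => //=; exact: card_le1_mem.
Qed.

(** Unless some part lies in [W0], three clusters are involved. If two coincide, the third shares
    two vertices with them and is equal to them; if all pairs share a single vertex,
    [clusters_no_triangle] is contradicted. *)
Lemma covered_triangle X Y Z x y z : covered X -> covered Y -> covered Z ->
  x \in X :&: Y -> y \in Y :&: Z -> z \in X :&: Z ->
  x != y -> y != z -> x != z -> covered (X :|: Y :|: Z) \/ step_in.
Proof.
move=> cX cY cZ xXY yYZ zXZ xy yz xz.
case: (cX) => [sX|[P [cP sPW sX]]]; first exact: covered_one xXY yYZ zXZ xy yz xz.
case: (cY) => [sY|[Q [cQ sQW sY]]].
  rewrite (setUC X Y).
  by apply: (@covered_one _ _ _ x z y); rewrite // 1?setIC // eq_sym.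
case: (cZ) => [sZ|[R [cR sRW sZ]]].
  rewrite setUC setUA.
  by apply: (@covered_one _ _ _ z x y); rewrite // 1?setIC // eq_sym.
have /setIP [xX xY] := xXY; have /setIP [yY yZ] := yYZ; have /setIP [zX zZ] := zXZ.
have xPQ : x \in vset P :&: vset Q by rewrite inE (subsetP sX) // (subsetP sY).
have yQR : y \in vset Q :&: vset R by rewrite inE (subsetP sY) // (subsetP sZ).
have zPR : z \in vset P :&: vset R by rewrite inE (subsetP sX) // (subsetP sZ).
have all_eq : P = Q -> P = R -> covered (X :|: Y :|: Z).
  by move=> eQ eR; right; exists P; rewrite !subUset sX eQ sY -eQ eR sZ -eR.
case: (ltnP 1 #|vset P :&: vset Q|) => [/(cluster_eq tG cP cQ) ePQ|PQ1].
  left; apply: all_eq => //; apply: (cluster_eq tG cP cR).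
  by apply: card_gt1_mem yz => //; rewrite ePQ.
case: (ltnP 1 #|vset P :&: vset R|) => [/(cluster_eq tG cP cR) ePR|PR1].
  have ePQ : P = Q.
    by apply: (cluster_eq tG cP cQ); apply: card_gt1_mem xPQ _ xy; rewrite setIC ePR.
  by left; apply: all_eq.
case: (ltnP 1 #|vset Q :&: vset R|) => [/(cluster_eq tG cQ cR) eQR|QR1].
  have ePQ : P = Q.
    by apply: (cluster_eq tG cP cQ); apply: card_gt1_mem xPQ _ xz; rewrite eQR.
  by left; apply: all_eq; rewrite ?ePQ.
have [tR sR _] := cR; exfalso.
by apply: (clusters_no_triangle cP cQ tR sR (card_le1_mem xPQ PQ1)
  (card_le1_mem zPR PR1) (card_le1_mem yQR QR1)); rewrite // eq_sym.
Qed.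

(* The clusters in [W] together with [W0] form a family in which no three
   members can be merged, so it absorbs every tree-decomposable subgraph. *)
Lemma td_covered D : tree_decomposable D -> subgraph D (add_edge G f) ->
  vset D \subset W -> covered (vset D) \/ step_in.
Proof.
elim=> {D} [u v uv|A B C x y z _ IA _ IB _ IC ABx BCy ACz xy yz xz] [sV sE] sW.
  have : [set u; v] \in eset (add_edge G f) by apply: (subsetP sE); rewrite /= uv inE.
  rewrite eset_add_edge // => /setU1P [/= ->|eG]; first by left; left; case: fc0.
  have [C cC eC] := tight_in_cluster tG (edge_tight tG eG).
  left; right; exists C; split=> //; have [_ _ _ sat] := fcW.
  exact: (sat C _ cC (cluster_edge tG cC eG eC) sW).
move: sV sE sW; rewrite /= !subUset -!andbA => /and3P [vA vB vC] /and3P [eA eB eC].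
move=> /and3P [wA wB wC].
have [//|cA|] := IA _ wA; last by right.
have [//|cB|] := IB _ wB; last by right.
have [//|cC|] := IC _ wC; last by right.
by apply: covered_triangle xy yz xz; rewrite // ?ABx ?BCy ?ACz inE.
Qed.

(** With [f] added, [W] induces a tree-decomposable graph. It cannot be covered: it does not fit in
    [W0], and no cluster contains both ends of [f]. *)
Lemma base_closed_progress : W0 \proper W -> step_in.
Proof.
move=> pW; have [fW sW _ _] := fcW.
have tW := base_closed_tight fcW.
have := td_covered (tight_td tGf tW); case=> //.
- by apply: induced_subgraph; case/and3P: tW.
- case=> [sW0|[C [cC _ sWC]]]; first by move: pW; rewrite properE sW0 andbF.
  have := base_not_tight bG (cluster_tight tG cC).
  by rewrite (subset_trans fW).
Qed.

End Progress.

(** Induction on the number of vertices of [W] outside [W0], which drops because the step vertex is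
    new. It serves both to reach a base-closed set from the pair [f] and to continue from it to all
    of [G]. *)
Lemma base_closed_ind (P : {set T} -> Prop) W0 W : base_closed G f W0 -> base_closed G f W ->
  W0 \subset W -> P W0 ->
  (forall X s, base_closed G f X -> valid_step G (induced G X) s -> P X ->
    P (X :|: vset (step_c s) :|: vset (step_c' s))) -> P W.
Proof.
move=> fc0 fcW; move: {2}#|_| (leqnn #|W :\: W0|) => n.
elim: n W0 fc0 => [|n IH] X fcX le_n sXW PX stepP.
  suff -> : W = X by [].
  by apply/eqP; rewrite eqEsubset sXW andbT -setD_eq0 -cards_eq0 -leqn0.
have [<- //|neXW] := eqVneq X W.
have [s [vs sC sC']] : exists s, [/\ valid_step G (induced G X) s,
    vset (step_c s) \subset W & vset (step_c' s) \subset W].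
  by apply: base_closed_progress; rewrite // properEneq neXW.
apply: (IH _ (append_base_closed fcX vs)) => //; last exact: stepP.
  rewrite -ltnS; apply: leq_trans le_n; apply: proper_card.
  have [vX _ _] := valid_step_apex vs; apply/properP; split.
    by apply: setDS; rewrite -setUA subsetUl.
  have /setIP [vC _] : step_v s \in vset (step_c s) :&: vset (step_c' s).
    by case: vs => _ ->; rewrite inE.
  by exists (step_v s); rewrite !inE ?vX ?(subsetP sC) ?vC ?orbT.
by rewrite !subUset sXW sC sC'.
Qed.

End Base.
End Closed.

(** * Low Cayley complexity *)

Section Complexity.
Variable T : finType.
Implicit Types (G H K A B C D : graph T) (X Y Z W : {set T}) (f : T * T).
Implicit Types (s t : step T).

Lemma induced_vset G : induced G (vset G) = G.
Proof.
by apply: graph_eq => //=; apply/setP => e; rewrite inE andb_idr // => /edge_sub.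
Qed.

(** The two sides of a step are interchangeable; the case analysis at the end treats one side and
    obtains the other by this swap. *)
Definition swap_step s :=
  Step (step_v s) (step_w s) (step_u s) (step_c' s) (step_c s).

Lemma valid_step_swap G H s : valid_step G H s -> valid_step G H (swap_step s).
Proof.
by move=> [[cC cC'] CC' CH C'H uw]; split; rewrite //= 1?setIC // eq_sym.
Qed.

Lemma append_step_swap H s : append_step H (swap_step s) = append_step H s.
Proof. by apply: graph_eq; rewrite /= setUAC. Qed.

Definition lcc_closed G f : Prop := forall W s, base_closed G f W ->
  valid_step G (induced G W) s ->
  tree_decomposable (add_edge (induced G W) (step_u s, step_w s)).

Lemma edgeless_induced G f : base_nonedge G f ->
  edgeless [set f.1; f.2] = induced G [set f.1; f.2].
Proof.
move=> bG; apply: graph_eq => //=; apply/esym/eqP; rewrite -cards_eq0.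
have [_ _ n0 _] := base_closed_pair bG.
by rewrite (fpair_card bG) in n0; rewrite -[#|_|]/(ne G _); apply/eqP; lia.
Qed.

Lemma built_rcons f (ss : seq (step T)) s :
  built f (rcons ss s) = append_step (built f ss) s.
Proof. by rewrite /built -cats1 foldl_cat. Qed.

(** By induction, each initial segment of a construction builds the subgraph induced on a
    base-closed set. *)
Lemma lcc_closed_LCC G f : base_nonedge G f -> lcc_closed G f -> LCC G f.
Proof.
move=> bG lG n ss [vss _] k.
have built_closed m : m <= n ->
    exists2 W, base_closed G f W & built f (take m ss) = induced G W.
  elim: m => [_|m IH lt_m].
    exists [set f.1; f.2]; first exact: base_closed_pair.
    by rewrite take0 -edgeless_induced.
  have [W fcW eW] := IH (ltnW lt_m); have := vss (Ordinal lt_m).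
  rewrite (tnth_nth (tnth ss (Ordinal lt_m))) /= eW.
  set s := nth _ _ _ => vs; exists (W :|: vset (step_c s) :|: vset (step_c' s)).
    exact: append_base_closed.
  rewrite (take_nth (tnth ss (Ordinal lt_m))) ?size_tuple // built_rcons eW.
  exact: (append_induced bG fcW vs).
have [W fcW eW] := built_closed k (ltnW (ltn_ord k)).
by rewrite /extreme_graph eW; apply: lG => //; rewrite -eW; apply: vss.
Qed.

(** The step condition of [construction] for lists of any length, which can be extended and
    concatenated; the default [s0] is never reached. *)
Definition valid_seq G f (ss : seq (step T)) : Prop := forall k s0, k < size ss ->
  valid_step G (built f (take k ss)) (nth s0 ss k).

Lemma valid_seq_rcons G f ss s : valid_seq G f ss ->
  valid_step G (built f ss) s -> valid_seq G f (rcons ss s).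
Proof.
move=> vss vs k s0; rewrite size_rcons ltnS leq_eqVlt => /orP [/eqP -> |lt_k].
  by rewrite -cats1 take_size_cat // nth_cat ltnn subnn.
by rewrite -cats1 takel_cat 1?ltnW // nth_cat lt_k; apply: vss.
Qed.

(** Every pair of a base-closed set and a valid next step occurs in some construction: build [W],
    perform [s], then continue up to [G]. *)
Lemma LCC_lcc_closed G f : base_nonedge G f -> LCC G f -> lcc_closed G f.
Proof.
move=> bG lG W s fcW vs.
have [ss [vss eW]] : exists ss, valid_seq G f ss /\ built f ss = induced G W.
  have [fW _ _ _] := fcW.
  apply: (base_closed_ind bG (base_closed_pair bG) fcW fW (P := fun X =>
    exists ss, valid_seq G f ss /\ built f ss = induced G X)).
    by exists [::]; split=> //; rewrite -edgeless_induced.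
  move=> X r fcX vr [ss [vss eX]]; exists (rcons ss r); split.
    by apply: valid_seq_rcons => //; rewrite eX.
  by rewrite built_rcons eX (append_induced bG fcX vr).
have fcW' := append_base_closed bG fcW vs.
have [ss' [vss' eG]] : exists ss', valid_seq G f (rcons ss s ++ ss') /\
    built f (rcons ss s ++ ss') = induced G (vset G).
  have [_ sW' _ _] := fcW'.
  apply: (base_closed_ind bG fcW' (base_closed_vset bG) sW' (P := fun X =>
    exists ss', valid_seq G f (rcons ss s ++ ss') /\
    built f (rcons ss s ++ ss') = induced G X)).
    exists [::]; rewrite cats0 built_rcons eW (append_induced bG fcW vs) //; split=> //.
    by apply: valid_seq_rcons => //; rewrite eW.
  move=> X r fcX vr [ss' [vss' eX]]; exists (rcons ss' r); rewrite -rcons_cat; split.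
    by apply: valid_seq_rcons => //; rewrite eX.
  by rewrite built_rcons eX (append_induced bG fcX vr).
(* The step [s] has index [size ss], so its extreme graph is the wanted one. *)
pose tt := in_tuple (rcons ss s ++ ss').
have lt_k : size ss < size (rcons ss s ++ ss').
  by rewrite size_cat size_rcons addSn ltnS leq_addr.
have cG : construction G f tt.
  split; last by rewrite /= eG induced_vset.
  by move=> k; rewrite (tnth_nth s); apply: vss'.
have := lG _ tt cG (Ordinal lt_k); rewrite /extreme_graph (tnth_nth s) /=.
by rewrite cat_rcons take_size_cat // nth_cat ltnn subnn eW.
Qed.

(** Each step is valid with respect to the graph just after it, not the final graph, so the property
    is inherited by every stage and mentions no base nonedge of the result. *)
Inductive lcc_graph : graph T -> Prop :=
| lcc_pair (x y : T) of x != y : lcc_graph (edgeless [set x; y])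
| lcc_append H s of lcc_graph H & valid_step (append_step H s) H s &
    tree_decomposable (add_edge H (step_u s, step_w s)) :
    lcc_graph (append_step H s).

(** A cluster of [G] contained in an intermediate graph is still a cluster there. *)
Lemma lcc_closed_graph G f : base_nonedge G f -> lcc_closed G f -> lcc_graph G.
Proof.
move=> bG lG; rewrite -(induced_vset G).
apply: (base_closed_ind bG (base_closed_pair bG) (base_closed_vset bG) (base_sub bG)
  (P := fun X => lcc_graph (induced G X))).
  by rewrite -edgeless_induced //; apply: lcc_pair; case: bG => -[].
move=> X s fcX vs lX; rewrite -(append_induced bG fcX vs); apply: lcc_append => //; last exact: lG.
have sG : subgraph (append_step (induced G X) s) G.
  by rewrite (append_induced bG fcX vs); apply: induced_subgraph; apply: append_sub fcX vs.
case: vs => -[cC cC'] CC' CX C'X uw; split=> //; split.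
  apply: cluster_subgraph cC sG _; split; rewrite /= setUAC; exact: subsetUr.
apply: cluster_subgraph cC' sG _; split; exact: subsetUr.
Qed.

Lemma step_not_inside G f W t : base_nonedge G f -> base_closed G f W ->
  valid_step G (induced G W) t ->
  ~~ (vset (step_c t) \subset W) /\ ~~ (vset (step_c' t) \subset W).
Proof.
move=> bG fcW [[cD cD'] _ /= DW D'W _]; have := cluster_card cD; have := cluster_card cD'.
by move=> D'2 D2; split; apply/negP => /setIidPl e;
  rewrite -e ?DW ?D'W cards1 in D2 D'2.
Qed.

(** A tight set containing both attachment vertices would form a triangle with the two clusters of
    the step. *)
Lemma step_not_tight G f W t Z : base_nonedge G f -> base_closed G f W ->
  valid_step G (induced G W) t -> tight G Z -> Z \subset W ->
  ~~ ((step_u t \in Z) && (step_w t \in Z)).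
Proof.
move=> bG fcW vt tZ sZW; apply/negP => /andP [uZ wZ].
have [_ vu vw] := valid_step_apex vt; case: vt => -[cD cD'] DD' /= DW D'W uw.
have cap D x : vset D :&: W = [set x] -> x \in Z -> vset D :&: Z = [set x].
  move=> DWx xZ; apply/eqP; rewrite eqEsubset -DWx setIS //= DWx sub1set inE xZ andbT.
  by have /setIP [] : x \in vset D :&: W by rewrite DWx inE.
have sZ : Z \subset vset G by case/and3P: tZ.
exact: (clusters_no_triangle cD cD' (tight_td (base_in_td bG) tZ)
  (induced_subgraph sZ) DD' (cap _ _ DW uZ) (cap _ _ D'W wZ)).
Qed.

Lemma setI_pair X x y : x \in X -> y \notin X -> X :&: [set x; y] = [set x].
Proof.
move=> xX yX; apply/setP => a; rewrite !inE.
case: (eqVneq a x) => [->|_]; first by rewrite xX.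
by apply: contraNF yX => /andP [aX /eqP <-].
Qed.

(** The new edge closes a triangle with [A] and [B], whose apices are [x], [r] and [q]. *)
Lemma td_hinge A B K x q r : tree_decomposable A -> tree_decomposable B ->
    vset A :&: vset B = [set x] -> q \in vset A -> q \notin vset B ->
    r \in vset B -> r \notin vset A ->
    vset K = vset A :|: vset B -> eset K = eset A :|: eset B ->
  tree_decomposable (add_edge K (q, r)).
Proof.
move=> tA tB ABx qA qB rB rA vK eK.
have /setIP [xA xB] : x \in vset A :&: vset B by rewrite ABx inE.
have qr : q != r by apply: contraNneq qB => ->.
have xr : x != r by apply: contraNneq rA => <-.
have xq : x != q by apply: contraNneq qB => <-.
apply: (@td_union_sub _ A B (single_edge (q, r)) _ x r q) => //.
- exact: td_edge.
- by rewrite /= setUC setI_pair.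
- by rewrite /= setI_pair.
- by rewrite eq_sym.
- by rewrite /= vK.
- by rewrite /= eK.
Qed.

(** * The last step of a graph, seen from an arbitrary base nonedge *)

Section Append.
Variables (H : graph T) (s : step T).
Let G := append_step H s.
Let C := step_c s.
Let C' := step_c' s.
Hypothesis vs : valid_step G H s.
Variable (f : T * T).
Hypothesis bG : base_nonedge G f.

Let tG : in_td G := base_in_td bG.
Let e := (step_u s, step_w s).

Lemma append_edge a : a \in eset G = [|| a \in eset H, a \in eset C | a \in eset C'].
Proof. by rewrite /= !inE orbA. Qed.

Lemma append_count W :
  ne G W = ne C W + ne C' W + ne H W /\
  #|W :&: vset G| + (step_v s \in W) + (step_w s \in W) + (step_u s \in W) =
    #|W :&: vset C| + #|W :&: vset C'| + #|W :&: vset H|.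
Proof.
have [_ vu vw] := valid_step_apex vs; case: (vs) => _ CC' CH C'H uw.
have -> : G = gunion (gunion C C') H.
  by apply: graph_eq; rewrite /= -setUA setUC.
split; first exact: triangle_ne CC' C'H CH W.
by apply: triangle_card => //; rewrite eq_sym.
Qed.

Lemma sub_append : subgraph H G.
Proof. by split; rewrite /= -setUA subsetUl. Qed.

Let tH : in_td H := in_td_subgraph tG sub_append.

(** An edge between the attachment vertices would form a triangle with the clusters [C] and [C']. *)
Lemma step_nonedge : nonedge H e.
Proof.
have [_ vu vw] := valid_step_apex vs; case: (vs) => -[cC cC'] CC' CH C'H uw.
have /setIP [uC uH] : step_u s \in vset C :&: vset H by rewrite CH inE.
have /setIP [wC' wH] : step_w s \in vset C' :&: vset H by rewrite C'H inE.
have wC : step_w s \notin vset C.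
  apply/negP => wC; have : step_w s \in vset C :&: vset H by rewrite inE wC.
  by rewrite CH inE eq_sym (negbTE uw).
have uC' : step_u s \notin vset C'.
  apply/negP => uC'; have : step_u s \in vset C' :&: vset H by rewrite inE uC'.
  by rewrite C'H inE (negbTE uw).
split=> //=; apply/negP => eH.
have sE : subgraph (single_edge e) G.
  apply: subgraph_trans sub_append; split; rewrite /= ?subUset ?sub1set ?uH ?wH //.
  by rewrite uw sub1set.
apply: (clusters_no_triangle cC cC' (td_edge uw) sE CC' _ _ vu vw uw).
  by rewrite /= setI_pair.
by rewrite /= setUC setI_pair.
Qed.

(** Such a cluster has no edge in [C] or [C'], so its edges are in [H]; its vertices follow, since
    each lies on an edge. *)
Lemma cluster_of_rest D : cluster G D -> #|vset D :&: vset C| <= 1 ->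
  #|vset D :&: vset C'| <= 1 -> vset D \subset vset H /\ cluster H D.
Proof.
move=> cD DC DC'; have [tD [_ sD] _] := cD.
have eD : eset D \subset eset H.
  apply/subsetP => a aD; have a2 := edge_card aD.
  have far B : #|vset D :&: vset B| <= 1 -> a \in eset B = false.
    move=> DB; apply/negP => aB; have : a \subset vset D :&: vset B.
      by rewrite subsetI !edge_sub.
    by move/subset_leq_card; rewrite a2 leqNgt ltnS DB.
  by have := subsetP sD a aD; rewrite append_edge (far C) // (far C') // !orbF.
have vD : vset D \subset vset H.
  apply/subsetP => x /(td_vertex_edge tD) [a aD xa].
  exact: (subsetP (edge_sub (subsetP eD a aD))).
by split=> //; apply: cluster_subgraph cD sub_append _.
Qed.

(** Closure transfers although clusters of [H] may be smaller than those of [G]: each lies in a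
    cluster of [G], which [W] absorbs. *)
Lemma base_closed_restrict W g : base_closed G f W -> [set g.1; g.2] \subset W :&: vset H ->
  ne H W + 4 = 2 * #|W :&: vset H| -> base_closed H g (W :&: vset H).
Proof.
move=> [_ _ _ sat] gW nW; split; rewrite ?subsetIr // ?ne_setI // => D a cD aD.
rewrite subsetI => /andP [aW _]; have [tD sD _] := cD; have [vD eD] := sD.
rewrite subsetI vD andbT; have sDG := subgraph_trans sD sub_append.
have [R cR sDR] := tight_in_cluster tG (td_tight tG tD sDG).
apply: (subset_trans sDR); apply: (sat R _ cR _ aW).
apply: (cluster_edge tG cR); first exact: (subsetP sDG.2).
exact: subset_trans (edge_sub aD) sDR.
Qed.

(** * Extreme graphs, according to how the set meets the last clusters *)

Section Step.
Variables (W : {set T}) (t : step T).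
Hypotheses (fcW : base_closed G f W) (vt : valid_step G (induced G W) t).

Let D := step_c t.
Let D' := step_c' t.
Let goal := tree_decomposable (add_edge (induced G W) (step_u t, step_w t)).

Lemma step_mem : step_u t \in W /\ step_w t \in W.
Proof.
case: vt => _ _ /= DW D'W _.
have /setIP [_ ->] : step_u t \in vset D :&: W by rewrite DW inE.
by have /setIP [_ ->] : step_w t \in vset D' :&: W by rewrite D'W inE.
Qed.

(** Here [W] is the union of [C] and [Y], its part in [H], which meet only in [step_u s]. Both are
    tight, so by [step_not_tight] neither contains both attachment vertices of [t], and the extreme
    graph is a triangle. *)
Lemma td_extreme_hinge : 1 < #|vset C :&: W| -> #|vset C' :&: W| <= 1 -> goal.
Proof.
move=> CW2 C'W1; case: (vs) => -[cC cC'] CC' CH C'H uw.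
have [vH vu vw] := valid_step_apex vs.
have sCW := base_closed_sat bG fcW cC CW2; have [fW sWG nW sat] := fcW.
have /setIP [vC vC'] : step_v s \in vset C :&: vset C' by rewrite CC' inE.
have /setIP [uC uH] : step_u s \in vset C :&: vset H by rewrite CH inE.
have /setIP [wC' wH] : step_w s \in vset C' :&: vset H by rewrite C'H inE.
have vW := subsetP sCW _ vC; have uW := subsetP sCW _ uC.
have C'W : vset C' :&: W = [set step_v s] by apply: card_le1_mem; rewrite // inE vC'.
have wW : step_w s \in W = false.
  apply/negP => wW; have : step_w s \in vset C' :&: W by rewrite inE wC'.
  by rewrite C'W inE eq_sym (negbTE vw).
pose Y := W :&: vset H.
have CY : vset C :&: Y = [set step_u s] by rewrite /Y setIA (setIidPl sCW) CH.
(* From |W| = |C| + |Y| - 1, the edges left for [Y] number (2 |W| - 4) - (2 |C| - 3) = 2 |Y| - 3. *)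
have tY : tight H Y.
  have [] := append_count W; rewrite vW uW wW (setIidPl sWG) (setIidPr sCW).
  rewrite [W :&: vset C']setIC C'W cards1 -(ne_setI C) -(ne_setI C') (setIidPr sCW).
  rewrite [W :&: vset C']setIC C'W (@ne_small _ C') ?cards1 // ne_vset.
  case: (cC) => /td_card [C2 eC] _ _.
  rewrite -[step_c s]/C in C2 eC.
  rewrite /tight /Y subsetIr ne_setI /= -/Y; move: nW C2 eC.
  move: (ne G W) (ne H W) #|W| #|Y| #|eset C| #|vset C|; clear; lia.
have [tYG eY] := tight_subgraph tG sub_append tY.
have tC : tree_decomposable C by case: cC.
have tDY := tight_td tG tYG.
have sYW : Y \subset W by apply: subsetIl.
have vW' : vset (induced G W) = vset C :|: vset (induced G Y).
  apply/eqP; rewrite eqEsubset /= subUset sCW sYW !andbT; apply/subsetP => x xW.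
  have := subsetP sWG x xW; rewrite /= !inE xW /= => /orP [/orP [->|->]|xC'].
  - exact: orbT.
  - by [].
  have : x \in vset C' :&: W by rewrite inE xC'.
  by rewrite C'W inE => /eqP ->; rewrite vC.
have eW' : eset (induced G W) = eset C :|: eset (induced G Y).
  rewrite -eY; apply/setP => a; rewrite inE append_edge !inE subsetI.
  case aH: (a \in eset H); case aC: (a \in eset C) => //=.
  - by rewrite (subset_trans (edge_sub aC)).
  - by rewrite (edge_sub aH) andbT.
  - by rewrite (subset_trans (edge_sub aC)).
  apply/andP => -[aC' aW]; have : a \subset [set step_v s].
    by rewrite -C'W subsetI (edge_sub aC').
  by move/subset_leq_card; rewrite cards1 (edge_card aC').
have [qW rW] := step_mem.
have nC := step_not_tight bG fcW vt (cluster_tight tG cC) sCW.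
have nY := step_not_tight bG fcW vt tYG sYW.
have cover x : x \in W -> (x \in vset C) || (x \in Y).
  by rewrite -{1}[W]/(vset (induced G W)) vW' inE.
rewrite /goal; case/orP: (cover _ qW) => q1; case/orP: (cover _ rW) => r1.
- by rewrite q1 r1 in nC.
- rewrite q1 in nC; rewrite r1 andbT in nY.
  exact: (@td_hinge C (induced G Y) _ (step_u s)).
- rewrite r1 andbT in nC; rewrite q1 in nY; rewrite add_edge_swap.
  exact: (@td_hinge C (induced G Y) _ (step_u s)).
by rewrite q1 r1 in nY.
Qed.

Lemma td_extreme_pair : #|W| = 2 -> goal.
Proof.
move=> W2; have [fW _ nW _] := fcW; have [qW rW] := step_mem.
have [_ _ _ _ qr] := vt.
have eW : W = [set step_u t; step_w t].
  by apply/esym/eqP; rewrite eqEcard subUset !sub1set qW rW cards2 qr W2.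
rewrite /goal (_ : add_edge _ _ = single_edge (step_u t, step_w t)); first exact: td_edge.
have n0 : edges_in G W = set0.
  by apply/eqP; rewrite -cards_eq0 -[#|_|]/(ne G W); apply/eqP; lia.
by apply: graph_eq; rewrite /= ?n0 ?set0U // -eW setUid.
Qed.

Hypothesis tHe : tree_decomposable (add_edge H e).

(** A step using [C] must be the last step: if [D'] were not [C'] it would lie in [H], and the step
    vertex of [t] would be a second common vertex of [C] and [H]. The extreme graph is then induced
    on a tight set of [H] plus [e]. *)
Lemma td_extreme_last : W \subset vset H -> D = C -> goal.
Proof.
move=> sWH eD; have [vH vu vw] := valid_step_apex vs; have [pW pq pr] := valid_step_apex vt.
case: (vs) => -[cC cC'] CC' CH C'H uw; case: (vt) => -[cD cD'] DD' /= DW D'W qr.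
have [qW rW] := step_mem; have [fW sW nW sat] := fcW.
have /setIP [pD pD'] : step_v t \in vset D :&: vset D' by rewrite DD' inE.
have /setIP [qD _] : step_u t \in vset D :&: W by rewrite DW inE.
have qu : step_u t = step_u s.
  have : step_u t \in vset C :&: vset H by rewrite inE -eD qD (subsetP sWH).
  by rewrite CH inE => /eqP.
have D'C : #|vset D' :&: vset C| <= 1 by rewrite -eD setIC DD' cards1.
have eD' : 1 < #|vset D' :&: vset C'|.
  rewrite ltnNge; apply/negP => D'C'.
  have [sD'H _] := cluster_of_rest cD' D'C D'C'.
  have : step_v t \in vset C :&: vset H by rewrite inE -eD pD (subsetP sD'H).
  by rewrite CH inE -qu (negbTE pq).
have {}eD' : D' = C' := cluster_eq tG cD' cC' eD'.
have rw : step_w t = step_w s.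
  have : step_w t \in vset C' :&: vset H.
    rewrite inE (subsetP sWH) // andbT -eD'.
    by have /setIP [] : step_w t \in vset D' :&: W by rewrite D'W inE.
  by rewrite C'H inE => /eqP.
have small B x : vset B :&: vset H = [set x] -> ne B W = 0.
  move=> BH; rewrite -ne_setI ne_small // -(cards1 x) -BH setIC.
  by apply: subset_leq_card; apply: setIS.
have nH : ne G W = ne H W.
  by have [-> _] := append_count W; rewrite (small C _ CH) (small C' _ C'H).
have eWH : induced H W = induced G W.
  apply: graph_eq => //=; apply/eqP; rewrite eqEcard -[#|edges_in G _|]/(ne G W) nH leqnn andbT.
  by apply/subsetP => a; rewrite !inE => /andP [-> ->].
have be : base_nonedge H e by split; first exact: step_nonedge.
have fcHe : tight (add_edge H e) W.
  have eW : [set e.1; e.2] \subset W by rewrite /= -qu -rw subUset !sub1set qW rW.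
  rewrite /tight vset_add_edge ?base_sub // sWH (fset_card be eW) /=.
  rewrite ne_add_edge ?eW; last exact: step_nonedge.
  by apply/eqP; move: nW; rewrite nH; clear; lia.
have := tight_td (add_base_in_td be) fcHe.
rewrite /goal -eWH qu rw (_ : induced _ _ = add_edge (induced H W) e) //.
apply: graph_eq; first by rewrite vset_add_edge //= -qu -rw subUset !sub1set qW rW.
rewrite eset_add_edge //; apply/setP => a; rewrite inE eset_add_edge // !inE.
by case: eqP => [->|] //=; rewrite -qu -rw subUset !sub1set qW rW.
Qed.

Hypothesis IH : forall g, base_nonedge H g -> lcc_closed H g.

(** Removing both clusters leaves a base-closed set [Y] of [H] for the nonedge [e], and [t] is still
    a valid step on it. The induction hypothesis is therefore used at [e], as [f] need not lie in
    [H]; gluing [C] and [C'] back forms a triangle. *)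
Lemma td_extreme_full : 1 < #|vset C :&: W| -> 1 < #|vset C' :&: W| -> goal.
Proof.
move=> CW2 C'W2; case: (vs) => -[cC cC'] CC' CH C'H uw.
have [vH vu vw] := valid_step_apex vs.
have sCW := base_closed_sat bG fcW cC CW2; have sC'W := base_closed_sat bG fcW cC' C'W2.
have [fW sWG nW sat] := fcW.
have /setIP [vC vC'] : step_v s \in vset C :&: vset C' by rewrite CC' inE.
have /setIP [uC uH] : step_u s \in vset C :&: vset H by rewrite CH inE.
have /setIP [wC' wH] : step_w s \in vset C' :&: vset H by rewrite C'H inE.
have vW := subsetP sCW _ vC; have uW := subsetP sCW _ uC; have wW := subsetP sC'W _ wC'.
have [DnW D'nW] := step_not_inside bG fcW vt.
case: (vt) => -[cD cD'] DD' /= DW D'W qr.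
have rest B : cluster G B -> ~~ (vset B \subset W) -> vset B \subset vset H /\ cluster H B.
  move=> cB nB; apply: cluster_of_rest => //; rewrite leqNgt; apply: contraNN nB.
    by move/(cluster_eq tG cB cC) ->.
  by move/(cluster_eq tG cB cC') ->.
have [sD cHD] := rest _ cD DnW; have [sD' cHD'] := rest _ cD' D'nW.
pose Y := W :&: vset H.
have be : base_nonedge H e by split; first exact: step_nonedge.
have fcY : base_closed H e Y.
  apply: base_closed_restrict => //=; first by rewrite subUset !sub1set !inE uW uH wW wH.
  have [] := append_count W; rewrite vW uW wW (setIidPl sWG) (setIidPr sCW) (setIidPr sC'W).
  rewrite -(ne_setI C) -(ne_setI C') (setIidPr sCW) (setIidPr sC'W) !ne_vset -/Y.
  case: (cC) => /td_card [_ eC] _ _; case: (cC') => /td_card [_ eC'] _ _.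
  rewrite -[step_c s]/C in eC; rewrite -[step_c' s]/C' in eC'; move: nW eC eC'.
  move: (ne G W) (ne H W) #|W| #|Y| #|eset C| #|vset C| #|eset C'| #|vset C'|; clear; lia.
have DY B : vset B \subset vset H -> vset B :&: Y = vset B :&: W.
  by move=> sB; rewrite /Y setIA setIAC (setIidPl sB).
have vtY : valid_step H (induced H Y) t by split; rewrite //= DY.
have tY := IH be fcY vtY.
have [qW rW] := step_mem.
have qD : step_u t \in vset D by have /setIP [] : step_u t \in vset D :&: W by rewrite DW inE.
have rD' : step_w t \in vset D' by have /setIP [] : step_w t \in vset D' :&: W by rewrite D'W inE.
have qY : step_u t \in Y by rewrite inE qW (subsetP sD).
have rY : step_w t \in Y by rewrite inE rW (subsetP sD').
have vY : vset (add_edge (induced H Y) (step_u t, step_w t)) = Y.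
  by rewrite vset_add_edge //= subUset !sub1set qY rY.
have vG : vset (add_edge (induced G W) (step_u t, step_w t)) = W.
  by rewrite vset_add_edge //= subUset !sub1set qW rW.
apply: (@td_union_sub _ C C' _ _ (step_v s) (step_w s) (step_u s) _ _ tY) => //.
- by case: cC.
- by case: cC'.
- by rewrite vY /Y setIA (setIidPl sC'W).
- by rewrite vY /Y setIA (setIidPl sCW).
- by rewrite eq_sym.
- rewrite vG vY; apply/eqP; rewrite eqEsubset !subUset sCW sC'W subsetIl !andbT.
  apply/subsetP => x xW; have := subsetP sWG x xW.
  by rewrite /= !inE xW /= => /orP [/orP [->|->]|->]; rewrite ?orbT.
rewrite !eset_add_edge // setUCA; congr (_ |: _); apply/setP => a.
rewrite inE append_edge !inE subsetI.
case aC: (a \in eset C) => /=; first by rewrite orbT (subset_trans (edge_sub aC)).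
case aC': (a \in eset C') => /=; first by rewrite orbT (subset_trans (edge_sub aC')).
by rewrite orbF; case aH: (a \in eset H) => //=; rewrite (edge_sub aH) andbT.
Qed.

(** A vertex of [W] outside [H] would be isolated in the graph on [W]; deleting it would leave n
    vertices with 2n - 2 edges, against sparsity. *)
Lemma rest_sub : #|vset C :&: W| <= 1 -> #|vset C' :&: W| <= 1 -> 2 < #|W| ->
  W \subset vset H /\ eset (induced G W) = eset (induced H W).
Proof.
move=> CW C'W W3; have [fW sWG nW _] := fcW.
have far B (a : {set T}) : #|vset B :&: W| <= 1 -> a \subset W -> a \in eset B = false.
  move=> BW aW; apply/negP => aB; have : a \subset vset B :&: W by rewrite subsetI edge_sub.
  by move/subset_leq_card; rewrite (edge_card aB) leqNgt ltnS BW.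
have eW (a : {set T}) : a \in eset G -> a \subset W -> a \in eset H.
  by move=> aG aW; rewrite append_edge (far C) // (far C') // !orbF in aG.
split; last first.
  apply/setP => a; rewrite inE [RHS]inE; apply/andP/andP => -[aG aW]; split=> //.
    exact: eW.
  exact: (subsetP sub_append.2 a aG).
apply/subsetP => x xW; apply: contraT => xH.
have W1 : #|W| = #|W :\ x|.+1 by rewrite (cardsD1 x) xW.
have x2 : 1 < #|W :\ x| by rewrite W1 in W3.
have : ne G W <= ne G (W :\ x).
  apply/subset_leq_card/subsetP => a; rewrite inE => /andP [aG aW].
  rewrite inE aG subsetD1 aW /=; apply: contraNN xH => xa.
  exact: (subsetP (edge_sub (eW a aG aW))).
have := in_td_sparse tG x2; move: nW; rewrite W1; clear; lia.
Qed.

(** Everything happens in [H]: [f] is a base nonedge of [H] and [t] a valid step there, so the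
    induction hypothesis at [f] applies. *)
Lemma td_extreme_rest : W \subset vset H -> eset (induced G W) = eset (induced H W) ->
  (forall B, B = D \/ B = D' -> #|vset B :&: vset C| <= 1 /\ #|vset B :&: vset C'| <= 1) ->
  goal.
Proof.
move=> sWH eWH far; have [fW sWG nW _] := fcW.
case: (vt) => -[cD cD'] DD' /= DW D'W qr.
have eW : induced G W = induced H W by apply: graph_eq.
have fH := subset_trans fW sWH.
have be : base_nonedge H e by split; first exact: step_nonedge.
have ndH : nonedge H f.
  case: bG => -[_ _ f12 fG] _; move: fH; rewrite subUset !sub1set => /andP [f1 f2].
  by split=> //; apply: contraNN fG; apply: (subsetP sub_append.2).
have f12 : f.1 != f.2 by case: ndH.
have bHf : base_nonedge H f.
  split=> //; have sHf : subgraph (add_edge H f) (add_edge G f).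
    by have [vH eH] := sub_append; split; rewrite /= setSU.
  have tHf := in_td_subgraph (add_base_in_td bG) sHf.
  rewrite -(induced_vset (add_edge H f)); apply: tight_td => //.
  (* The number of edges of [H] is read off from its other base nonedge [e]. *)
  have [_ _ nH _] := base_closed_vset be.
  rewrite /tight subxx vset_add_edge // (fset_card bG fH) ne_add_edge // fH /=.
  by apply/eqP; move: nH; clear; lia.
have WY : W :&: vset H = W by apply/setIidPl.
have fcH : base_closed H f W.
  rewrite -WY; apply: base_closed_restrict; rewrite // WY // -nW; congr (_ + _).
  by rewrite -[ne H W]/#|eset (induced H W)| -eWH.
have [DC DC'] := far D (or_introl erefl); have [D'C D'C'] := far D' (or_intror erefl).
have [_ cHD] := cluster_of_rest cD DC DC'; have [_ cHD'] := cluster_of_rest cD' D'C D'C'.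
by rewrite /goal eW; apply: (IH bHf fcH); split.
Qed.

End Step.
End Append.

(** By saturation [W] contains each of the two last clusters or meets it in at most one vertex,
    whence four cases. *)
Lemma lcc_closed_append H s f : let G := append_step H s in
  valid_step G H s -> tree_decomposable (add_edge H (step_u s, step_w s)) ->
  (forall g, base_nonedge H g -> lcc_closed H g) ->
  base_nonedge G f -> lcc_closed G f.
Proof.
move=> G vs te IH bG W t fcW vt; have tG := base_in_td bG.
have te' : tree_decomposable (add_edge H (step_w s, step_u s)) by rewrite add_edge_swap.
have vt' := valid_step_swap vt.
have eG := append_step_swap H s.
case: (ltnP 1 #|vset (step_c s) :&: W|) => CW; case: (ltnP 1 #|vset (step_c' s) :&: W|) => C'W.
- exact: (td_extreme_full vs bG).
- exact: (td_extreme_hinge vs bG).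
- have := @td_extreme_hinge H (swap_step s); cbv zeta; rewrite eG => hinge.
  exact: (hinge (valid_step_swap vs) _ bG _ _ fcW vt).
have [fW _ _ _] := fcW; have := fset_card bG fW.
rewrite leq_eqVlt => /orP [/eqP W2|W3]; first by apply: (td_extreme_pair fcW vt); rewrite -W2.
have [sWH eWH] := rest_sub bG fcW CW C'W W3.
have [cC cC'] : cluster G (step_c s) /\ cluster G (step_c' s) by case: vs.
have [cD cD'] : cluster G (step_c t) /\ cluster G (step_c' t) by case: vt.
(* Stated for any step [r], so that it applies to [t] and to its swap, whichever of the two clusters
   is a last one. *)
have last1 r : valid_step G (induced G W) r ->
    1 < #|vset (step_c r) :&: vset (step_c s)| \/ 1 < #|vset (step_c r) :&: vset (step_c' s)| ->
    tree_decomposable (add_edge (induced G W) (step_u r, step_w r)).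
  move=> vr; have cR : cluster G (step_c r) by case: vr => -[].
  case=> [/(cluster_eq tG cR cC)|/(cluster_eq tG cR cC')] eR.
    exact: (td_extreme_last vs bG).
  have := @td_extreme_last H (swap_step s); cbv zeta; rewrite eG => last.
  exact: (last (valid_step_swap vs) _ bG _ _ fcW vr).
have last2 := last1 _ vt'; rewrite add_edge_swap in last2.
case: (ltnP 1 #|vset (step_c t) :&: vset (step_c s)|) => DC; first by apply: last1; last left.
case: (ltnP 1 #|vset (step_c t) :&: vset (step_c' s)|) => DC'; first by apply: last1; last right.
case: (ltnP 1 #|vset (step_c' t) :&: vset (step_c s)|) => D'C; first by apply: last2; left.
case: (ltnP 1 #|vset (step_c' t) :&: vset (step_c' s)|) => D'C'; first by apply: last2; right.
by apply: (td_extreme_rest vs bG) => // B [] ->.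
Qed.

Lemma lcc_graph_closed G : lcc_graph G ->
  forall f, base_nonedge G f -> lcc_closed G f.
Proof.
elim=> {G} [x y xy f _ W s _ [[[/td_card [D2 eD] [_ sD] _] _] _ _ _ _]|H s _ IH vs te f bG].
  (* An edgeless graph has no cluster, hence no valid step. *)
  by have := subset_leq_card sD; rewrite cards0; move: D2 eD; clear; lia.
exact: lcc_closed_append.
Qed.

End Complexity.

Theorem theorem1 (T : finType) (G : graph T)
    (hG : one_dof_tree_decomposable G) :
  (forall f : T * T, base_nonedge G f -> LCC G f) \/
  (forall f : T * T, base_nonedge G f -> ~ LCC G f).
Proof.
(* Excluded middle decides whether some base nonedge is good; if so, [lcc_graph] carries the
   property over to all others. *)
have [[f [bf lf]]|none] := Classical_Prop.classic (exists f, base_nonedge G f /\ LCC G f).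
  left=> g bg; apply: lcc_closed_LCC => //; apply: lcc_graph_closed bg.
  exact: lcc_closed_graph bf (LCC_lcc_closed bf lf).
by right=> f bf lf; apply: none; exists f.
Qed.
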